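(* Let $C$ be a cycle of goods and $N=\{1,2,3\}$ a set of three agents with arbitrary utility functions on $C$. Then there exists a $\frac56$-sufficient allocation of the goods of $C$ to the agents in $N$.
   Context: A cycle of goods has goods $v_1,\dots,v_m$ with edges $v_iv_{i+1}$ and $v_mv_1$. A utility function assigns a non-negative real to each good, extended additively to sets. A bundle is a set of goods inducing a connected subgraph (empty allowed); an $n$-split is a sequence of $n$ pairwise disjoint bundles (possibly empty) with union all goods. $\mathrm{mms}^{(n)}(C,u)=\max_{P_1,\dots,P_n}\min_i u(P_i)$ over all $n$-splits. An allocation to agents $1,\dots,n$ with utilities $u_1,\dots,u_n$ is an $n$-split $P_1,\dots,P_n$ with $P_i$ given to agent $i$; for $c>0$ it is $c$-sufficient if $u_i(P_i)\ge c\cdot\mathrm{mms}^{(n)}(C,u_i)$ for all $i$. *)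

(* Defs.v *)
From HB Require Import structures.
From mathcomp Require Import all_boot all_order all_algebra.
Set Implicit Arguments. Unset Strict Implicit. Unset Printing Implicit Defensive.
Import Order.TTheory GRing.Theory Num.Theory.
Local Open Scope ring_scope.

(* The cycle of goods v_1..v_m is modelled by 'I_m (v_{k+1} <-> k);
   edges join k and (k+1) mod m. *)
Definition cyc_adj (m : nat) (i j : 'I_m) : bool :=
  (nat_of_ord j == i.+1 %% m)%N || (nat_of_ord i == j.+1 %% m)%N.

Definition bundle (m : nat) (S : {set 'I_m}) : bool :=
  [forall x in S, forall y in S,
     connect (fun a b => [&& a \in S, b \in S & cyc_adj a b]) x y].

Definition is_split (n m : nat) (P : {ffun 'I_n -> {set 'I_m}}) : bool :=
  [&& [forall i, bundle (P i)],
      [forall i, forall j, (i != j) ==> [disjoint P i & P j]] &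
      (\bigcup_(i < n) P i == [set: 'I_m])].

Definition usum (R : realFieldType) (m : nat) (u : 'I_m -> R) (S : {set 'I_m}) : R :=
  \sum_(g in S) u g.

(* min_i u(P_i).  The neutral element u(all goods) is an upper bound of every
   u(P_i) for non-negative u, so for n >= 1 this is exactly the minimum. *)
Definition split_min (R : realFieldType) (n m : nat) (u : 'I_m -> R)
    (P : {ffun 'I_n -> {set 'I_m}}) : R :=
  \big[Num.min/usum u [set: 'I_m]]_(i < n) usum u (P i).

(* mms^(n)(C,u) = max over n-splits of min_i u(P_i).  Splits always exist and
   values are >= 0 for non-negative u, so starting the max at 0 is harmless. *)
Definition mms (R : realFieldType) (n m : nat) (u : 'I_m -> R) : R :=
  \big[Num.max/0]_(P : {ffun 'I_n -> {set 'I_m}} | is_split P) split_min u P.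

Definition c_sufficient (R : realFieldType) (n m : nat) (c : R)
    (us : 'I_n -> 'I_m -> R) (P : {ffun 'I_n -> {set 'I_m}}) : Prop :=
  is_split P /\ forall i : 'I_n, c * mms n (us i) <= usum (us i) (P i).

(* Main.v *)
Require Import Defs.
From HB Require Import structures.
From mathcomp Require Import all_boot all_order all_algebra.
From mathcomp Require Import zify lra.
Set Implicit Arguments. Unset Strict Implicit. Unset Printing Implicit Defensive.
Import Order.TTheory GRing.Theory Num.Theory.
Local Open Scope ring_scope.

(* Fix for every agent a maximin split, and lower her utility until each of its
   parts is worth exactly her maximin share.  Suppose no 5/6-sufficient allocation
   exists.  When agent A offers her three parts, the other two agents must accept
   (at 5/6) one and the same part only.  If A takes one of the two other parts,
   the rest is worth at least 13/6 to both B and C, so it cannot be cut into two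
   pieces acceptable to either of them (the other one would choose); this forces
   exactly one cut of B and one cut of C strictly inside that part.  Hence the
   cuts of the three agents strictly interlace, say a b c a b c a b c around the
   cycle.  For agents A, B consecutive in this order, comparing the parts of A and
   of B that the others accept leaves only one of three relative positions: if the
   part of B starts just after that of A, there is an explicit allocation; if it
   is the next one, the utility of C is contradictory; so it is the one just
   before.  Going round A, B, C, A, this is impossible modulo 3. *)

(* The cycle is unrolled to the integers: goods are integers modulo [m], [pref] is
   the primitive of the utility, and part [s] of the agent's split is the interval
   from [cut s] to [cut (s + 1)], worth [level]. *)
Record agent (R : realFieldType) (m : int) := Agent {
  pref : int -> R;
  cut : int -> int;
  level : R;
  pref_homo : {homo pref : x y / x <= y};
  pref_period : forall x, pref (x + m) = pref x + 3 * level;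
  cut_leS : forall s, cut s <= cut (s + 1);
  cut_period : forall s, cut (s + 3) = cut s + m;
  pref_cutS : forall s, pref (cut (s + 1)) = pref (cut s) + level }.

Lemma residue3 (s : int) : exists q : int, [\/ s = 3 * q, s = 3 * q + 1 | s = 3 * q + 2].
Proof.
exists (s %/ 3)%Z; have := divz_eq s 3.
have := ltz_pmod s (isT : 0 < 3 :> int); have := @modz_ge0 s 3 isT.
move: (s %% 3)%Z (s %/ 3)%Z => x y x0 x3 E.
have [Ex|[Ex|Ex]] : x = 0 \/ x = 1 \/ x = 2 by lia.
- by apply: Or31; lia.
- by apply: Or32; lia.
- by apply: Or33; lia.
Qed.

(** * Agents on the unrolled cycle: cuts and acceptable intervals *)

Section Core.
Variables (R : realFieldType) (m : int).
Hypothesis m_gt0 : 0 < m.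
Implicit Types A B C : agent R m.

Definition ok A (p q : int) : bool := 5 / 6 * level A <= pref A q - pref A p.

(** Only the numbering of the parts changes. Being transparent, it leaves [noalloc] of renumbered
    agents convertible to [noalloc] of the original ones. *)
Definition shift A (k : int) : agent R m.
Proof.
refine (@Agent R m (pref A) (fun s => cut A (s + k)) (level A)
  (@pref_homo _ _ A) (@pref_period _ _ A) _ _ _).
- by move=> s; rewrite addrAC cut_leS.
- by move=> s; rewrite addrAC cut_period.
- by move=> s; rewrite addrAC pref_cutS.
Defined.

Definition stuck A B C := forall p q r : int, p <= q -> q <= r -> r <= p + m ->
  ~~ [&& ok A p q, ok B q r & ok C r (p + m)].

(** These are the two cyclic orders of the agents around the cycle; moving the starting point gives
    the other four orders. *)
Definition noalloc A B C := stuck A B C /\ stuck A C B.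

(** The index is that of the remaining part: parts [s + 1] and [s + 2] of [A] are the two that [B]
    rejects. *)
Definition light A B (s : int) : bool :=
  ~~ ok B (cut A (s + 1)) (cut A (s + 2)) && ~~ ok B (cut A (s + 2)) (cut A (s + 3)).

Definition interlaced A B := forall i, cut A i < cut B i < cut A (i + 1).

Definition ordered A B C :=
  forall i, [&& cut A i < cut B i, cut B i < cut C i & cut C i < cut A (i + 1)].

Lemma level_ge0 A : 0 <= level A.
Proof.
by have := pref_homo A (cut_leS A 0); rewrite pref_cutS lerDl.
Qed.

Lemma cut_homo A : {homo cut A : s t / s <= t}.
Proof.
move=> s t; rewrite -subr_ge0; case E : (t - s) => [n|//] _.
have -> : t = s + n%:Z by lia.
elim: n {E} => [|n IH]; first by rewrite addr0.
by apply: le_trans IH _; rewrite -addn1 PoszD addrA cut_leS.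
Qed.

Lemma cut_lt_inv A (s t : int) : cut A s < cut A t -> s < t.
Proof. by apply: contraTT; rewrite -!leNgt; apply: cut_homo. Qed.

Lemma cut_periodM A (s k : int) : cut A (s + 3 * k) = cut A s + k * m.
Proof.
have H (n : nat) t : cut A (t + 3 * n%:Z) = cut A t + n%:Z * m.
  elim: n => [|n IH]; first by rewrite !(mulr0, mul0r, addr0).
  have -> : t + 3 * n.+1%:Z = t + 3 * n%:Z + 3 by lia.
  by rewrite cut_period IH; lia.
case: (intP k) => [|n|n]; [exact: (H 0%N) | exact: (H n.+1) |].
by have := H n.+1 (s + 3 * - n.+1%:Z); rewrite mulrN subrK => ->; lia.
Qed.

Lemma ok_period A p q : ok A (p + m) (q + m) = ok A p q.
Proof. by rewrite /ok !pref_period; congr (_ <= _); lra. Qed.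

Lemma ok_sub A p p' q q' : p' <= p -> q <= q' -> ok A p q -> ok A p' q'.
Proof.
move=> /(pref_homo A) Hp /(pref_homo A) Hq; rewrite /ok; lra.
Qed.

Lemma ok_periodM A (p q k : int) : ok A (p + k * m) (q + k * m) = ok A p q.
Proof.
have H (n : nat) x y : ok A (x + n%:Z * m) (y + n%:Z * m) = ok A x y.
  elim: n => [|n IH]; first by rewrite !mul0r !addr0.
  by rewrite -[n.+1]addn1 PoszD !mulrDl !mul1r !addrA ok_period.
case: (intP k) => [|n|n]; [exact: (H 0%N) | exact: (H n.+1) |].
by rewrite -[LHS](H n.+1) mulNr !subrK.
Qed.

Lemma ok_cut A s p q : p <= cut A s -> cut A (s + 1) <= q -> ok A p q.
Proof.
move=> Hp Hq; apply: ok_sub Hp Hq _.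
by rewrite /ok pref_cutS; have := level_ge0 A; lra.
Qed.

Lemma stuck_rot A B C : stuck A B C -> stuck B C A.
Proof.
move=> S p q r pq qr rp; have := S (r - m) p q.
rewrite -(ok_period A (r - m)) subrK => S'.
by apply: contra (S' _ _ _); [case/and3P=> -> -> -> | lia..].
Qed.

Lemma noalloc_rot A B C : noalloc A B C -> noalloc B C A.
Proof.
by case=> S1 S2; split; [apply: stuck_rot | apply: stuck_rot; apply: stuck_rot].
Qed.

Lemma noalloc_swap A B C : noalloc A B C -> noalloc A C B.
Proof. by case. Qed.

Lemma lightD3 A B s : light A B (s + 3) = light A B s.
Proof.
rewrite /light !(addrAC s 3) !cut_period ok_period; congr (_ && ~~ _).
by rewrite ok_period.
Qed.

(** Each of [B] and [C] accepts some part of [A], since three rejected parts would total less than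
    5/2 of a level instead of 3. If they accepted two different parts, [A] could take the third; so
    both accept one and the same part only. *)
Lemma heavy_part A B C : noalloc A B C -> exists s, light A B s && light A C s.
Proof.
case=> S1 S2.
have c3 : cut A 3 = cut A 0 + m by rewrite -(cut_period A 0).
have c01 : cut A 0 <= cut A 1 := cut_leS A 0.
have c12 : cut A 1 <= cut A 2 := cut_leS A 1.
have c23 : cut A 2 <= cut A 3 := cut_leS A 2.
have oA s : ok A (cut A s) (cut A (s + 1)) by apply: ok_cut.
have oA0 : ok A (cut A 0) (cut A 1) := oA 0.
have oA1 : ok A (cut A 1) (cut A 2) := oA 1.
have oA2 : ok A (cut A 2) (cut A 3) := oA 2.
have some D : [|| ok D (cut A 0) (cut A 1), ok D (cut A 1) (cut A 2) | ok D (cut A 2) (cut A 3)].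
  apply: contraT; rewrite !negb_or /ok -!ltNge => /and3P[h0 h1 h2].
  have := level_ge0 D; have := pref_period D (cut A 0); rewrite -c3; lra.
(* The three clauses let [A] take part 0, 1 or 2; the next part goes to [D] and the one after it to
   [E]. *)
have bad D E : stuck A D E ->
  [/\ ~~ (ok D (cut A 1) (cut A 2) && ok E (cut A 2) (cut A 3)),
      ~~ (ok D (cut A 2) (cut A 3) && ok E (cut A 0) (cut A 1)) &
      ~~ (ok D (cut A 0) (cut A 1) && ok E (cut A 1) (cut A 2))].
  move=> S; split.
  - by have := S _ _ _ c01 c12; rewrite -c3 oA0; apply.
  - have c41 : cut A 3 <= cut A 1 + m by rewrite c3; lia.
    by have := S _ _ _ c12 c23 c41; rewrite oA1 c3 ok_period; apply.
  - have c41 : cut A 3 <= cut A 1 + m by rewrite c3; lia.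
    have c52 : cut A 1 + m <= cut A 2 + m by lia.
    by have := S _ _ _ c23 c41 c52; rewrite oA2 c3 !ok_period; apply.
have [b1 b2 b3] := bad _ _ S1; have [b4 b5 b6] := bad _ _ S2.
have sB := some B; have sC := some C.
have c4 : cut A 4 = cut A 1 + m by rewrite -(cut_period A 1).
have c5 : cut A 5 = cut A 2 + m by rewrite -(cut_period A 2).
have l0 D : light A D 0 = ~~ ok D (cut A 1) (cut A 2) && ~~ ok D (cut A 2) (cut A 3).
  by [].
have l1 D : light A D 1 = ~~ ok D (cut A 2) (cut A 3) && ~~ ok D (cut A 0) (cut A 1).
  by rewrite /light [cut A (1 + 3)]c4 c3 ok_period.
have l2 D : light A D 2 = ~~ ok D (cut A 0) (cut A 1) && ~~ ok D (cut A 1) (cut A 2).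
  by rewrite /light [cut A (2 + 3)]c5 [cut A (2 + 2)]c4 [cut A (2 + 1)]c3 !ok_period.
suff : (light A B 0 && light A C 0) || (light A B 1 && light A C 1)
    || (light A B 2 && light A C 2).
  by case/orP=> [/orP[]|] H; [exists 0 | exists 1 | exists 2].
rewrite !l0 !l1 !l2.
move: b1 b2 b3 b4 b5 b6 sB sC.
by do 6 case: (ok _ _ _).
Qed.

(** * Interlacing of the cuts of two agents *)

Lemma cut_straddle A x : exists t, cut A t <= x < cut A (t + 1).
Proof.
(* A turn has length at least 1, so [N] turns either way carry [cut A 0] past [x]. *)
pose N := (absz x + absz (cut A 0)).+1.
have NM : N%:Z <= N%:Z * m by rewrite ler_peMr //; lia.
have [Nlo Nhi] : cut A 0 - N%:Z <= x /\ x < cut A 0 + N%:Z by rewrite /N; split; lia.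
clearbody N.
have lo : cut A (- (3 * N%:Z)) <= x.
  have := cut_periodM A 0 (- N%:Z); rewrite add0r mulrN mulNr => ->.
  by apply: le_trans Nlo; rewrite lerD2l lerN2.
have hi : x < cut A (- (3 * N%:Z) + (6 * N)%N%:Z).
  have -> : - (3 * N%:Z) + (6 * N)%N%:Z = 3 * N%:Z by lia.
  by have := cut_periodM A 0 N%:Z; rewrite add0r => ->; apply: lt_le_trans Nhi _; rewrite lerD2l.
move: (- (3 * N%:Z)) (6 * N)%N lo hi => t; elim=> [|n IH] lo hi.
  by move: hi; rewrite addr0 ltNge lo.
have [|H] := ltP x (cut A (t + n%:Z)); first exact: IH.
by exists (t + n%:Z); rewrite H -addrA -PoszD addn1.
Qed.

(* If B could split the rest of the cycle into two acceptable bundles, A would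
   take the light part and C, whose rest is worth more than 13/6 of its level,
   would choose the better of the two. *)
Lemma rest_indivisible A B C s q :
  noalloc A B C -> ~~ ok C (cut A s) (cut A (s + 1)) ->
  cut A (s + 1) <= q -> q <= cut A s + m ->
  ~~ (ok B (cut A (s + 1)) q && ok B q (cut A s + m)).
Proof.
case=> S1 S2 nC aq qa; apply/negP=> /andP[oB1 oB2].
have oA : ok A (cut A s) (cut A (s + 1)) by apply: ok_cut.
have := S1 _ _ _ (cut_leS A s) aq qa; rewrite oA oB1 /=.
have := S2 _ _ _ (cut_leS A s) aq qa; rewrite oA oB2 andbT /=.
move: nC; rewrite /ok -!ltNge pref_period.
have := level_ge0 C; lra.
Qed.

(** With no cut of [B] strictly inside the part, the rest would contain two whole parts of [B] and
    be divisible; with two such cuts, the rejected part would contain a whole part of [B]. Cutting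
    the rest at either neighbouring cut of [B] leaves a whole part of hers on one side, so the
    protruding piece on the other side is rejected. *)
Lemma light_straddle A B C s : noalloc A B C ->
  ~~ ok B (cut A s) (cut A (s + 1)) -> ~~ ok C (cut A s) (cut A (s + 1)) ->
  exists t, [&& cut B t < cut A s, cut A s < cut B (t + 1),
    cut B (t + 1) < cut A (s + 1), cut A (s + 1) < cut B (t + 2),
    ~~ ok B (cut B t) (cut A s) & ~~ ok B (cut A (s + 1)) (cut B (t + 2))].
Proof.
move=> NA nB nC; have [t /andP[t0 t1]] := cut_straddle B (cut A s).
have aS := cut_leS A s.
have e1 : t + 1 + 1 = t + 2 by lia.
have e2 : t + 2 + 1 = t + 3 by lia.
have b12 := cut_leS B (t + 1); have b23 := cut_leS B (t + 2).
have b3 := cut_period B t; rewrite e1 in b12; rewrite e2 in b23.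
have t2 : cut A (s + 1) < cut B (t + 2).
  by rewrite ltNge; apply: contra nB => H; apply: (@ok_cut _ (t + 1));
     rewrite ?e1 // ltW.
have part2 x y : x <= cut B (t + 2) -> cut B t + m <= y -> ok B x y.
  by move=> ? ?; apply: (@ok_cut _ (t + 2)); rewrite // e2 b3.
have b2m : cut B (t + 2) <= cut A s + m by rewrite (le_trans b23) // b3 lerD2r.
have part2' : ok B (cut B (t + 2)) (cut A s + m) by rewrite part2 ?lerD2r.
have inside : cut B (t + 1) < cut A (s + 1).
  rewrite ltNge; apply/negP => H.
  have := rest_indivisible NA nC (ltW t2) b2m.
  by rewrite part2' (@ok_cut _ (t + 1)) ?e1.
have nr : ~~ ok B (cut A (s + 1)) (cut B (t + 2)).
  by have := rest_indivisible NA nC (ltW t2) b2m; rewrite part2' andbT.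
have nl : ~~ ok B (cut B t) (cut A s).
  have a1m : cut A (s + 1) <= cut B t + m by rewrite -b3 (le_trans (ltW t2)).
  have tm : cut B t + m <= cut A s + m by rewrite lerD2r.
  have := rest_indivisible NA nC a1m tm.
  by rewrite (part2 _ _ (ltW t2)) // ok_period.
exists t; rewrite t1 t2 inside nl nr !andbT lt_neqAle t0 andbT.
(* If the two cuts coincided, parts [t] and [t + 1] of [B], worth two levels, would consist of two
   rejected pieces. *)
apply/eqP => E; move: nr nB; rewrite /ok -!ltNge -E.
have := pref_cutS B t; have := pref_cutS B (t + 1); rewrite e1.
have := level_ge0 B; lra.
Qed.

(** Parts [s + 1] and [s + 2] of [A] each hold exactly one cut of [B]. These two cuts are
    consecutive, and periodicity puts the third one strictly inside part [s]. *)
Lemma interlace A B C s : noalloc A B C -> light A B s -> light A C s ->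
  exists k : int, interlaced A (shift B k).
Proof.
move=> NA /andP[B1 B2] /andP[C1 C2].
have e1 : s + 2 = s + 1 + 1 by lia.
have e2 : s + 3 = s + 2 + 1 by lia.
rewrite e1 in B1 C1; rewrite e2 in B2 C2.
have [t] := light_straddle NA B1 C1; case/and5P=> h1 h2 h3 h4 _.
have [t'] := light_straddle NA B2 C2; case/and5P=> g1 g2 g3 g4 _.
rewrite -!e2 -!e1 in h1 h2 h3 h4 g1 g2 g3 g4.
have tt' : t' = t + 1.
  have : t < t' + 1 by apply: (@cut_lt_inv B); lia.
  have : t' < t + 2 by apply: (@cut_lt_inv B); lia.
  have : t + 1 < t' + 1 by apply: (@cut_lt_inv B); lia.
  lia.
subst t'; have f1 : t + 1 + 1 = t + 2 by lia.
have f2 : t + 1 + 2 = t + 3 by lia.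
rewrite f1 f2 in g1 g2 g3 g4.
(* The cut [t] of [B] lies in part [s] of [A], so it is renumbered [s]. *)
exists (t - s) => i /=.
have [k Hk] := residue3 (i - s).
have a3 := cut_period A s; rewrite a3 in g3 g4; rewrite cut_period ltrD2r in g4.
have is_k x : i - s = 3 * k + x -> i = s + x + 3 * k by lia.
case: Hk => [E|/is_k ->|/is_k ->].
- have -> : i = s + 3 * k by lia.
  have -> : s + 3 * k + (t - s) = t + 3 * k by lia.
  have -> : s + 3 * k + 1 = s + 1 + 3 * k by lia.
  by rewrite !cut_periodM ?a3; lia.
- have -> : s + 1 + 3 * k + (t - s) = t + 1 + 3 * k by lia.
  have -> : s + 1 + 3 * k + 1 = s + 2 + 3 * k by lia.
  by rewrite !cut_periodM ?a3; lia.
- have -> : s + 2 + 3 * k + (t - s) = t + 2 + 3 * k by lia.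
  have -> : s + 2 + 3 * k + 1 = s + 3 + 3 * k by lia.
  by rewrite !cut_periodM ?a3; lia.
Qed.

Lemma pinch A B C s : noalloc A B C -> interlaced A B ->
  ~~ ok B (cut A s) (cut A (s + 1)) -> ~~ ok C (cut A s) (cut A (s + 1)) ->
  ~~ ok B (cut B (s - 1)) (cut A s) /\ ~~ ok B (cut A (s + 1)) (cut B (s + 1)).
Proof.
move=> NA AB nB nC; have [t] := light_straddle NA nB nC.
case/and5P=> h1 h2 h3 h4 /andP[nl nr].
have := AB s; have := AB (s - 1); rewrite subrK => H1 H2.
have lt_ts : t < s by apply: (@cut_lt_inv B); lia.
have lt_st : s - 1 < t + 1 by apply: (@cut_lt_inv B); lia.
have Et : t = s - 1 by lia.
have E2 : t + 2 = s + 1 by lia.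
by rewrite E2 in nr; rewrite -Et.
Qed.

(* The last four clauses concern the pieces of [B]'s parts that stick out of the
   two parts of [A] that [B] rejects, when the cuts of [A] and [B] interlace. *)
Definition pinched A B s :=
  [/\ light A B s,
   ~~ ok B (cut B s) (cut A (s + 1)), ~~ ok B (cut A (s + 2)) (cut B (s + 2)),
   ~~ ok B (cut B (s + 1)) (cut A (s + 2)) & ~~ ok B (cut A (s + 3)) (cut B (s + 3))].

Lemma light_pinched A B C s : noalloc A B C -> interlaced A B ->
  light A B s -> light A C s -> pinched A B s.
Proof.
move=> NA AB LB /andP[C1 C2]; case/andP: (LB) => B1 B2.
have e1 : s + 2 = s + 1 + 1 by lia.
have e2 : s + 3 = s + 2 + 1 by lia.
have e3 : s + 2 - 1 = s + 1 by lia.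
rewrite e1 in B1 C1; rewrite e2 in B2 C2.
have [] := pinch NA AB B1 C1; rewrite addrK -e1 => h1 h2.
have [] := pinch NA AB B2 C2; rewrite e3 -e2 => h3 h4.
by rewrite /pinched; split.
Qed.

(** * Relative positions of the parts that the others accept *)

Lemma pref_cut3 A B s : pref B (cut A (s + 3)) = pref B (cut A s) + 3 * level B.
Proof. by rewrite cut_period pref_period. Qed.

(** To [C], part [s] of [A] and part [s] of [B] are worth more than 4/3 of a level each, but their
    union less than 5/3, as [cut C s] divides it into two rejected pieces. Hence their overlap is
    worth more than one level and can go to [C]; what remains contains part [s + 1] of [A] followed
    by part [s + 2] of [B]. *)
Lemma heavy_not_adjacent A B C s : noalloc A B C -> ordered A B C ->
  pinched A C s -> pinched B C s -> False.
Proof.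
move=> [S _] O [/andP[l1 l2] _ _ _ l6] [/andP[k1 k2] k3 _ _ _].
have /and3P[ab bc ca] := O s; have /and3P[ab1 _ _] := O (s + 1).
have /and3P[ab2 _ _] := O (s + 2); have /and3P[ab3 _ _] := O (s + 3).
have e1 : s + 2 = s + 1 + 1 by lia.
have e2 : s + 3 = s + 2 + 1 by lia.
have oC : ok C (cut B s) (cut A (s + 1)).
  have := level_ge0 C; move: l1 l2 l6 k1 k2 k3; rewrite /ok -!ltNge !pref_cut3; lra.
have oA : ok A (cut A (s + 1)) (cut B (s + 2)).
  by apply: (@ok_cut _ (s + 1)); rewrite // -e1 ltW.
have oB : ok B (cut B (s + 2)) (cut B (s + 3)).
  by apply: (@ok_cut _ (s + 2)); rewrite // -e2.
have := S (cut A (s + 1)) (cut B (s + 2)) (cut B (s + 3)).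
rewrite oA oB cut_period ok_period oC /= => H.
have b23 := cut_leS B (s + 2); rewrite -e2 cut_period in b23.
have a12 := cut_leS A (s + 1); rewrite -e1 in a12.
suff : false by []; apply: H => //; first exact: le_trans a12 (ltW ab2).
by rewrite lerD2r ltW // (lt_trans bc).
Qed.

(** Part [s] of [A] and part [s + 1] of [B] do not overlap and are worth to [C] more than 4/3 of a
    level each. Yet the stretch from [cut A s] to [cut B (s + 2)] is one part of [C] with a rejected
    piece at either end, less than 8/3. *)
Lemma heavy_not_opposite A B C s : ordered A B C ->
  pinched A C s -> pinched B C (s + 1) -> False.
Proof.
move=> O [/andP[l1 l2] _ _ _ l6] [/andP[k1 k2] k3 _ _ _].
have /and3P[/ltW /(pref_homo C) ab _ _] := O (s + 1).
have e1 : s + 1 + 1 = s + 2 by lia.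
have c1 := pref_cutS C s.
move: l1 l2 l6 k1 k2 k3; rewrite /ok -!ltNge !pref_cut3 e1; lra.
Qed.

Lemma light_periodM A B (s k : int) : light A B (s + 3 * k) = light A B s.
Proof.
have H (n : nat) t : light A B (t + 3 * n%:Z) = light A B t.
  elim: n => [|n IH]; first by rewrite mulr0 addr0.
  have -> : t + 3 * n.+1%:Z = t + 3 * n%:Z + 3 by lia.
  by rewrite lightD3.
case: (intP k) => [|n|n]; [exact: (H 0%N) | exact: (H n.+1) |].
by rewrite -[LHS](H n.+1) mulrN subrK.
Qed.

Lemma ordered_rot A B C : ordered A B C -> ordered B C (shift A 1).
Proof.
by move=> O i; have /and3P[h1 h2 h3] := O i; have /and3P[g1 _ _] := O (i + 1); apply/and3P.
Qed.

Definition heavy A B C (s : int) := light A B s && light A C s.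

(** Both parts are judged by [C]; the residues 0 and 1 of [t - s] modulo 3 are excluded by the two
    lemmas on pinched parts. *)
Lemma heavy_step A B C (s t : int) : noalloc A B C -> ordered A B C ->
  heavy A B C s -> heavy B A C t -> exists k : int, t = s + 2 + 3 * k.
Proof.
move=> NA O /andP[sB sC] /andP[tA tC].
have AC : interlaced A C by move=> i; have /and3P[] := O i; lia.
have BC : interlaced B C.
  by move=> i; have /and3P[_ -> h] := O i; have /and3P[g _ _] := O (i + 1); lia.
have pA := light_pinched (noalloc_swap NA) AC sC sB.
have pB u k : t = u + 3 * k -> pinched B C u.
  move=> E; rewrite E !light_periodM in tA tC.
  exact: light_pinched (noalloc_rot NA) BC tC tA.
have [k [] E] := residue3 (t - s).
- by case: (heavy_not_adjacent NA O pA (pB s k _)); lia.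
- by case: (heavy_not_opposite O pA (pB (s + 1) k _)); lia.
- by exists k; lia.
Qed.

Lemma light_shift A B k s : light (shift A k) B s = light A B (s + k).
Proof. by rewrite /light /= !(addrAC s _ k). Qed.

(** Three steps of 2 add up to 0 modulo 3, whereas coming back to [A] renumbers her parts by one and
    turns [s] into [s - 1]. *)
Lemma ordered_alloc A B C : noalloc A B C -> ordered A B C -> False.
Proof.
move=> NA O.
have NB := noalloc_rot NA; have NC := noalloc_rot NB.
have [s /andP[sB sC]] := heavy_part NA.
have [t /andP[tC tA]] := heavy_part NB.
have [r /andP[rA rB]] := heavy_part NC.
have OB := ordered_rot O; have OC := ordered_rot OB.
have hA : heavy A B C s by apply/andP; split.
have hB : heavy B A C t by apply/andP; split.
have hB' : heavy B C (shift A 1) t by apply/andP; split.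
have hC : heavy C B (shift A 1) r by apply/andP; split.
have hC' : heavy C (shift A 1) (shift B 1) r by apply/andP; split.
have hA' : heavy (shift A 1) C (shift B 1) (s - 1).
  by rewrite /heavy !light_shift subrK sC.
have [k1 E1] := heavy_step NA O hA hB.
have [k2 E2] := heavy_step (NB : noalloc B C (shift A 1)) OB hB' hC.
have [k3 E3] := heavy_step (NC : noalloc C (shift A 1) (shift B 1)) OC hC' hA'.
by move: E1 E2 E3; clear; lia.
Qed.

Lemma alloc_exists A B C : ~ noalloc A B C.
Proof.
move=> NA; have [s /andP[sB sC]] := heavy_part NA.
have [k kB] := interlace NA sB sC.
have [j jC] := interlace (noalloc_swap NA) sC sB.
set B' := shift B k in kB; set C' := shift C j in jC.
have NA' : noalloc A B' C' := NA.
have NB' := noalloc_rot NA'.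
have [t /andP[tC tA]] := heavy_part NB'.
have [i iC] := interlace NB' tC tA.
(* Each part of [A] holds one cut of [B'] and one of [C']. Their interlacing fixes the same order in
   every part: [i = 0] puts [B'] first, [i = 1] puts [C'] first. *)
have : i = 0 \/ i = 1.
  have /andP[i1 i2] := iC 0; have /andP[b0 _] := kB 0; have /andP[_ b1] := kB 1.
  have /andP[c0 c1] := jC i; rewrite /= !add0r in b0 i1 i2.
  have : 0 < i + 1.
    by apply: (@cut_lt_inv A); exact: lt_trans b0 (lt_trans i1 c1).
  have : i < 1 + 1.
    by apply: (@cut_lt_inv A); exact: lt_trans c0 (lt_trans i2 b1).
  lia.
case=> E; subst i.
- apply: (@ordered_alloc A B' C') => // l.
  have := iC l; have := kB l; have := jC l; rewrite /= addr0; lia.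
- apply: (@ordered_alloc A C' B'); first exact: noalloc_swap.
  move=> l.
  have := iC (l - 1); have := kB l; have := jC l; rewrite /= subrK; lia.
Qed.
End Core.

(** * The maximin share as the value of a split *)

Section Mms.
Variables (R : realFieldType) (n m : nat) (u : 'I_m -> R).

Lemma split_min_le (P : {ffun 'I_n -> {set 'I_m}}) i : split_min u P <= usum u (P i).
Proof. by rewrite /split_min (bigD1 i) //= ge_min lexx. Qed.

Lemma mms_ge0 : 0 <= mms n u.
Proof. exact: bigmax_ge_id. Qed.

Lemma mms_attained : mms n u = 0 \/
  exists2 P : {ffun 'I_n -> {set 'I_m}}, is_split P & forall i, mms n u <= usum u (P i).
Proof.
suff [->|[P sP ->]] : mms n u = 0 \/
  exists2 P : {ffun 'I_n -> {set 'I_m}}, is_split P & mms n u = split_min u P.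
- by left.
- by right; exists P => // i; apply: split_min_le.
pose K x := x = 0 \/ exists2 P : {ffun 'I_n -> {set 'I_m}}, is_split P & x = split_min u P.
apply: (big_ind K) => [|x y Hx Hy|P sP]; first by left.
- by rewrite /Num.max; case: ifP.
- by right; exists P.
Qed.

End Mms.

(** * Arcs of the cycle and prefix sums *)

Section Arcs.
Variables (R : realFieldType) (n : nat).
Local Notation m := n.+1.
Implicit Types (u v : 'I_m -> R) (a b c e p q r : nat).

(** Endpoints are unrolled positions, so an arc running past the last good still has [a <= b]. *)
Definition arc a b : {set 'I_m} := [set x in map inZp (index_iota a b)].

Lemma arcP a b (x : 'I_m) :
  reflect (exists2 j, (a <= j < b)%N & x = inZp j) (x \in arc a b).
Proof.
rewrite inE; apply: (iffP mapP) => -[j Hj ->]; exists j => //.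
- by rewrite mem_index_iota in Hj.
- by rewrite mem_index_iota.
Qed.

Lemma inZp_addn j : inZp (j + m) = inZp j :> 'I_m.
Proof. by apply: val_inj; rewrite /= modnDr. Qed.

Lemma inZp_inj_window a j k : (a <= j < a + m)%N -> (a <= k < a + m)%N ->
  inZp j = inZp k :> 'I_m -> j = k.
Proof.
move=> Hj Hk /(congr1 val) /= E.
wlog jk : j k Hj Hk E / (j <= k)%N.
  by move=> W; case: (leqP j k) => [/W -> //|/ltnW /W ->].
move/eqP: E; rewrite eq_sym eqn_mod_dvd // => /dvdn_leq; lia.
Qed.

Lemma arc_uniq a b : (b <= a + m)%N -> uniq (map inZp (index_iota a b) : seq 'I_m).
Proof.
move=> ab; rewrite map_inj_in_uniq ?iota_uniq // => j k.
rewrite !mem_index_iota => Hj Hk; apply: (@inZp_inj_window a); lia.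
Qed.

Definition psum u k := \sum_(0 <= j < k) u (inZp j).

Lemma psum_cat u a b : (a <= b)%N -> psum u b = psum u a + \sum_(a <= j < b) u (inZp j).
Proof. by move=> ab; rewrite /psum (big_cat_nat (leq0n a) ab). Qed.

Lemma psum_ord u : psum u m = usum u [set: 'I_m].
Proof.
rewrite /psum big_mkord /usum; apply: eq_big => [i|i _]; first by rewrite inE.
by rewrite valZpK.
Qed.

Lemma psum_period u k : psum u (k + m) = psum u k + usum u [set: 'I_m].
Proof.
rewrite addnC (@psum_cat _ m) ?leq_addr // psum_ord addrC; congr (_ + _).
rewrite addnC -{1}[m]add0n big_addn addnK.
by apply: eq_bigr => i _; rewrite inZp_addn.
Qed.

Lemma usum_arc u a b : (a <= b)%N -> (b <= a + m)%N ->
  usum u (arc a b) = psum u b - psum u a.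
Proof.
move=> ab bm; rewrite (psum_cat u ab) addrAC subrr add0r.
rewrite -(big_map inZp xpredT) /usum [RHS]big_uniq ?arc_uniq //=.
by apply: eq_bigl => x; rewrite inE.
Qed.

Lemma cyc_adjS j : cyc_adj (inZp j : 'I_m) (inZp j.+1).
Proof. by rewrite /cyc_adj /= -addn1 -[in X in _ == X]addn1 modnDml eqxx. Qed.

Lemma cyc_adjC (x y : 'I_m) : cyc_adj x y = cyc_adj y x.
Proof. by rewrite /cyc_adj orbC. Qed.

Lemma bundle_arc a b : bundle (arc a b).
Proof.
pose e (x y : 'I_m) := [&& x \in arc a b, y \in arc a b & cyc_adj x y].
have e_sym : connect_sym e.
  by apply: sym_connect_sym => x y; rewrite /e andbCA cyc_adjC.
have from_a j : (a <= j < b)%N -> connect e (inZp a) (inZp j).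
  elim: j => [|j IH] Hj; first by have -> : a = 0%N by lia.
  have [->|aj] := eqVneq a j.+1; first exact: connect0.
  apply: connect_trans (IH _) (connect1 _); first lia.
  rewrite /e cyc_adjS andbT.
  by apply/andP; split; apply/arcP; [exists j | exists j.+1] => //; lia.
apply/forallP=> x; apply/implyP=> /arcP[j Hj ->].
apply/forallP=> y; apply/implyP=> /arcP[k Hk ->].
by apply: connect_trans (from_a k Hk); rewrite e_sym from_a.
Qed.

Lemma window a (x : 'I_m) : exists2 j, (a <= j < a + m)%N & x = inZp j.
Proof.
(* Modulo [m = n + 1], [a * n] stands for [- a], so the offset is the residue of [x - a]. *)
exists (a + (x + a * n) %% m)%N; first by have := ltn_pmod (x + a * n) (ltn0Sn n); lia.
apply: val_inj; rewrite /= modnDmr addnCA -mulnS addnC modnMDl.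
by rewrite modn_small.
Qed.

Lemma split_of_arcs (i j k : 'I_3) p q r : (p <= q)%N -> (q <= r)%N -> (r <= p + m)%N ->
  uniq [:: i; j; k] ->
  exists P : {ffun 'I_3 -> {set 'I_m}},
    [/\ forall x, [|| x == i, x == j | x == k], is_split P,
        P i = arc p q, P j = arc q r & P k = arc r (p + m)].
Proof.
move=> pq qr rm U.
have ijk x : [|| x == i, x == j | x == k].
  have [_ /(_ x)] : (size [:: i; j; k] = size (enum 'I_3)) * ([:: i; j; k] =i enum 'I_3).
    apply: uniq_min_size => // [y _|]; first by rewrite mem_enum.
    by rewrite size_enum_ord.
  by rewrite !inE mem_enum => ->.
(* [f] gives the endpoints of an agent's arc and [h] the owner of a position; uniqueness of the
   owner yields disjointness. *)
pose f x := if x == i then (p, q) else if x == j then (q, r) else (r, p + m)%N.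
pose h s := if (s < q)%N then i else if (s < r)%N then j else k.
have fI x s : ((f x).1 <= s < (f x).2)%N -> x = h s.
  rewrite /f /h; have := ijk x; have [-> _|_] := eqVneq x i => /=.
    by case/andP=> _ ->.
  have [-> _|_ /eqP ->] := eqVneq x j => /=.
    by case/andP=> qs ->; rewrite ltnNge qs.
  by case/andP=> rs _; rewrite !ltnNge rs (leq_trans qr rs).
have fW x : (p <= (f x).1)%N /\ ((f x).2 <= p + m)%N.
  by rewrite /f; case: (x == i); [|case: (x == j)]; split => /=; lia.
exists [ffun x => arc (f x).1 (f x).2]; rewrite !ffunE /f !eqxx.
move: U; rewrite /= !inE negb_or andbT => /andP[/andP[ij ik] jk].
rewrite [j == i]eq_sym [k == i]eq_sym [k == j]eq_sym.
rewrite (negbTE ij) (negbTE ik) (negbTE jk); split=> //.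
apply/and3P; split.
- by apply/forallP=> x; rewrite ffunE bundle_arc.
- apply/forallP=> x; apply/forallP=> y; apply/implyP=> xy.
  rewrite !ffunE disjoint_subset; apply/subsetP=> z /arcP[s Hs ->].
  rewrite inE /=; apply/arcP=> -[t Ht] /(@inZp_inj_window p) st.
  rewrite -[if x == i then _ else _]/(f x) in Hs; rewrite -[if y == i then _ else _]/(f y) in Ht.
  have [[s0 s1] [t0 t1]] := (fW x, fW y).
  have st' : s = t by apply: st; lia.
  by case/eqP: xy; rewrite (fI _ _ Hs) st' -(fI _ _ Ht).
- rewrite eqEsubset subsetT; apply/subsetP=> x _.
  have [t Ht ->] := window p x.
  have [tq|qt] := ltnP t q; last have [tr|rt] := ltnP t r.
  + by apply/bigcupP; exists i; rewrite // ffunE /f eqxx; apply/arcP; exists t; rewrite //=; lia.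
  + apply/bigcupP; exists j; rewrite // ffunE /f eq_sym (negbTE ij) eqxx.
    by apply/arcP; exists t; rewrite //=; lia.
  + apply/bigcupP; exists k; rewrite // ffunE /f ![k == _]eq_sym (negbTE ik) (negbTE jk).
    by apply/arcP; exists t; rewrite //=; lia.
Qed.

(** * The parts of a split lie in consecutive arcs *)

Lemma inZpS j : inZp (inZp j : 'I_m).+1 = inZp j.+1 :> 'I_m.
Proof. by apply: val_inj; rewrite /= -addn1 modnDml addn1. Qed.

(* Cut the cycle open just before [e]: a bundle not containing both ends of the
   resulting path is an interval of it. *)
Lemma bundle_interval (S : {set 'I_m}) e x y z : bundle S ->
  ~~ ((inZp e \in S) && (inZp (e + n) \in S)) ->
  (e <= x)%N -> (x < y)%N -> (y < z)%N -> (z < e + m)%N ->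
  inZp x \in S -> inZp z \in S -> inZp y \in S.
Proof.
move=> bS nee ex xy yz ze Sx Sz; apply: contraT => nSy.
pose r (a b : 'I_m) := [&& a \in S, b \in S & cyc_adj a b].
have r_sym : connect_sym r.
  by apply: sym_connect_sym => a b; rewrite /r andbCA cyc_adjC.
(* With [y] outside [S], no edge within [S] leaves this arc: forwards it would reach [y], backwards
   it would join [e] to [e + n]. So [x] and [z] are separated. *)
have cl : closed r [in arc e y].
  apply: intro_closed => // a b /and3P[Sa Sb ab] /arcP[t Ht Ea].
  have [s Hs Eb] := window e b.
  suff : (s < y)%N by move=> sy; apply/arcP; exists s => //; lia.
  case/orP: ab => [/eqP ab|/eqP ba].
  - have Eb' : b = inZp t.+1 by rewrite -inZpS -Ea; apply: val_inj.
    have ty : (t.+1 < y)%N.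
      rewrite ltn_neqAle; apply/andP; split; last by lia.
      by apply: contra nSy => /eqP <-; rewrite -Eb'.
    suff -> : s = t.+1 by [].
    by apply: (@inZp_inj_window e); rewrite -?Eb -?Eb' //; lia.
  - have Ea' : a = inZp s.+1 by rewrite -inZpS -Eb; apply: val_inj.
    have [se|se] := ltnP s.+1 (e + m).
      have : t = s.+1 by apply: (@inZp_inj_window e); rewrite -?Ea -?Ea' //; lia.
      by lia.
    have E : s = (e + n)%N by lia.
    case/negP: nee; rewrite -E -Eb Sb andbT.
    by move: Sa; rewrite Ea' E -addnS inZp_addn.
have cxz : connect r (inZp x) (inZp z).
  by move/forall_inP: bS => /(_ _ Sx) /forall_inP /(_ _ Sz).
have := closed_connect cl cxz.
have -> : inZp x \in [in arc e y] by apply/arcP; exists x => //; lia.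
move/esym/arcP => -[t Ht /(@inZp_inj_window e) E].
have : z = t by apply: E; lia.
by lia.
Qed.

Lemma split_eq (P : {ffun 'I_3 -> {set 'I_m}}) i j x : is_split P ->
  x \in P i -> x \in P j -> i = j.
Proof.
case/and3P=> _ /forallP/(_ i)/forallP/(_ j) D _ xi xj.
apply/eqP; apply: contraT => ij; move: D; rewrite ij /= => /pred0P/(_ x).
by rewrite /= xi xj.
Qed.

(** The cycle is opened at a border of [P ord0], so no part contains both ends and each is an
    interval. The parts are ordered by their first positions [lo], which serve as cuts. *)
Lemma split_cuts (P : {ffun 'I_3 -> {set 'I_m}}) : is_split P -> (forall i, P i != set0) ->
  exists e c1 c2, [/\ (e <= c1)%N, (c1 <= c2)%N & (c2 <= e + m)%N] /\
  exists i j k, [/\ P i \subset arc e c1, P j \subset arc c1 c2 & P k \subset arc c2 (e + m)].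
Proof.
move=> sP nP; have bP i : bundle (P i) by case/and3P: sP => /forallP.
(* Without such a border, [P ord0] would be closed under successors and swallow the other parts. *)
have [g Pg nPg] : exists2 g : nat, inZp g \in P ord0 & inZp g.+1 \notin P ord0.
  have /set0Pn[x Px] := nP ord0; have /set0Pn[y Py] := nP ord_max.
  case: (boolP [forall g in P ord0, inZp g.+1 \in P ord0]) => [/forall_inP H|].
    have all0 j : inZp (x + j) \in P ord0.
      elim: j => [|j IH]; first by rewrite addn0 valZpK.
      by rewrite addnS -inZpS H.
    have [j /andP[xj _] Ey] := window x y.
    by have := split_eq sP (all0 (j - x)%N); rewrite subnKC // -Ey => /(_ _ Py).
  case/forall_inPn=> g Pg nPg; exists g => //.
  by rewrite valZpK.
pose e := g.+1.
have nee i : ~~ ((inZp e \in P i) && (inZp (e + n) \in P i)).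
  apply/negP=> /andP[H1]; rewrite /e addSnnS inZp_addn => H2.
  by case/negP: nPg; rewrite (split_eq sP Pg H2).
have exlo i : exists k, (e <= k)%N && (inZp k \in P i).
  have /set0Pn[x Px] := nP i; have [j /andP[ej _] E] := window e x.
  by exists j; rewrite ej -E.
pose lo i := ex_minn (exlo i).
have [loe [loP lomin]] : (forall i, e <= lo i)%N /\ (forall i, inZp (lo i) \in P i) /\
    (forall i k, (e <= k)%N -> inZp k \in P i -> (lo i <= k)%N).
  split; [|split] => i; rewrite /lo; case: ex_minnP => k /andP[ek Pk] Hk //.
  by move=> l el Pl; apply: Hk; rewrite el.
have lt_lo i j z : (lo i < lo j)%N -> (z < e + m)%N -> inZp z \in P i -> (z < lo j)%N.
  move=> ij ze Pz; rewrite ltnNge; apply/negP; rewrite leq_eqVlt => /orP[/eqP E|jz].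
    by rewrite -E in Pz; move: ij; rewrite (split_eq sP (loP j) Pz) ltnn.
  have := bundle_interval (bP i) (nee i) (loe i) ij jz ze (loP i) Pz.
  by move=> H; move: ij; rewrite (split_eq sP (loP j) H) ltnn.
have loem i : (lo i < e + m)%N.
  have /set0Pn[x Px] := nP i; have [j /andP[ej je] E] := window e x.
  by apply: leq_ltn_trans je; apply: lomin; rewrite // -E.
have main i j k : (lo i < lo j)%N -> (lo j < lo k)%N -> exists e c1 c2,
    [/\ (e <= c1)%N, (c1 <= c2)%N & (c2 <= e + m)%N] /\ exists i j k,
    [/\ P i \subset arc e c1, P j \subset arc c1 c2 & P k \subset arc c2 (e + m)].
  move=> ij jk; exists e, (lo j), (lo k); split; first by split; rewrite // ltnW.
  exists i, j, k; split; apply/subsetP=> x; have [z /andP[ez ze] ->] := window e x => Px;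
    apply/arcP; exists z => //.
  - by rewrite ez (lt_lo i).
  - by rewrite lomin //= (lt_lo j).
  - by rewrite lomin //= ze.
have neq i j : i != j -> (lo i < lo j)%N || (lo j < lo i)%N.
  move=> ij; rewrite -neq_ltn; apply: contra ij => /eqP E.
  by have := loP j; rewrite -E => /(split_eq sP (loP i)) ->.
pose i1 : 'I_3 := inord 1.
have n01 : ord0 != i1 by rewrite -val_eqE /= inordK.
have n02 : ord0 != ord_max :> 'I_3 by [].
have n12 : i1 != ord_max by rewrite -val_eqE /= inordK.
case/orP: (neq _ _ n01) => h01; case/orP: (neq _ _ n02) => h02;
  case/orP: (neq _ _ n12) => h12;
  by [apply: main h01 h12 | apply: main h02 h12 | apply: main h12 h02 |
      apply: main h12 h01 | apply: main h01 h02 | apply: main h02 h01 | lia].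
Qed.

(** * Lowering a utility to parts of equal worth *)

Lemma psum_homo v a b : (forall x, 0 <= v x) -> (a <= b)%N -> psum v a <= psum v b.
Proof. by move=> v0 ab; rewrite (psum_cat v ab) lerDl sumr_ge0. Qed.

Lemma usum_sub v (S T : {set 'I_m}) : (forall x, 0 <= v x) -> S \subset T ->
  usum v S <= usum v T.
Proof.
move=> v0 ST; rewrite /usum [leRHS](big_setID S) /= (setIidPr ST) lerDl.
by apply: sumr_ge0.
Qed.

Lemma normal_form u : (forall x, 0 <= u x) ->
  exists v, (forall x, 0 <= v x <= u x) /\
  exists e c1 c2, [/\ (e <= c1)%N, (c1 <= c2)%N & (c2 <= e + m)%N] /\
  [/\ psum v c1 = psum v e + mms 3 u, psum v c2 = psum v c1 + mms 3 u &
      psum v (e + m) = psum v c2 + mms 3 u].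
Proof.
move=> u0.
(* A zero share is served by the zero utility with all cuts at 0. A positive one makes every part
   non-empty and its worth invertible. *)
have [M0|M0] := eqVneq (mms 3 u) 0.
  exists (fun=> 0); split; first by move=> x; rewrite lexx u0.
  exists 0%N, 0%N, 0%N; split; first by [].
  have psum0 k : psum (fun=> 0) k = 0 by apply: big1.
  by rewrite M0 !psum0 addr0.
have [/eqP|[P sP MP]] := mms_attained 3 u; first by rewrite (negbTE M0).
have {M0} : 0 < mms 3 u by rewrite lt_neqAle eq_sym M0 mms_ge0.
move: (mms 3 u) MP => M MP M0.
have U0 i : 0 < usum u (P i) := lt_le_trans M0 (MP i).
(* Rescaling on each part makes all parts worth exactly the maximin share. *)
pose v x := \sum_i if x \in P i then M * u x / usum u (P i) else 0.
have vE i x : x \in P i -> v x = M * u x / usum u (P i).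
  move=> xi; rewrite /v (bigD1 i) //= xi big1 ?addr0 // => j ji.
  by case: ifP => // xj; rewrite (split_eq sP xj xi) eqxx in ji.
have usumv i : usum v (P i) = M.
  rewrite /usum (eq_bigr _ (vE i)) -mulr_suml -mulr_sumr mulfK //.
  by rewrite gt_eqF // U0.
have tot : usum v [set: 'I_m] = 3 * M.
  rewrite /usum (eq_bigl xpredT) => [|x]; last by rewrite inE.
  rewrite exchange_big /= (eq_bigr (fun=> M)) => [|i _].
    by rewrite sumr_const card_ord mulr_natl.
  rewrite -big_mkcond -[RHS](usumv i) /usum; apply: eq_bigr => x xi.
  by rewrite (vE _ _ xi).
have v0 x : 0 <= v x <= u x.
  have /bigcupP[i _ xi] : x \in \bigcup_i P i.
    by case/and3P: sP => _ _ /eqP ->; rewrite inE.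
  rewrite (vE _ _ xi); apply/andP; split.
    by apply: divr_ge0; [apply: mulr_ge0 | ]; rewrite // ltW.
  by rewrite ler_pdivrMr // mulrC ler_wpM2l.
have v0' x : 0 <= v x by case/andP: (v0 x).
exists v; split=> //.
have [i|e [c1 [c2 [[h1 h2 h3] [i [j [k [Pi Pj Pk]]]]]]]] := split_cuts sP.
  apply/eqP=> E; have := U0 i; rewrite E /usum big_set0 ltxx //.
exists e, c1, c2; split=> //.
(* Each arc contains a part, hence is worth at least [M]; the total [3 * M] forces equality. *)
have := psum_period v e; rewrite tot.
move: (usum_sub v0' Pi) (usum_sub v0' Pj) (usum_sub v0' Pk).
rewrite !usumv !usum_arc //; try lia.
by split; lra.
Qed.

(** * From a utility on the cycle to an agent on the integers *)

Definition ipref v (x : int) : R :=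
  psum v `|(x %% m)%Z|%N + usum v [set: 'I_m] * (x %/ m)%Z%:~R.

Lemma iprefM v (x k : int) :
  ipref v (x + k * m) = ipref v x + usum v [set: 'I_m] * k%:~R.
Proof.
by rewrite /ipref [x + _]addrC divzMDl // modzMDl intrD mulrDr addrCA addrC.
Qed.

Lemma ipref_nat v a : ipref v a = psum v a.
Proof.
rewrite /ipref modz_nat divz_nat absz_nat [in RHS](divn_eq a m) addnC.
elim: (a %/ m)%N => [|k IH]; first by rewrite mulr0 mul0n addn0 addr0.
rewrite mulSn (addnC m) addnA psum_period -IH.
by rewrite -[k.+1]addn1 PoszD intrD mulrDr mulr1 addrA.
Qed.

Lemma ipref_homo v : (forall x, 0 <= v x) -> {homo ipref v : x y / x <= y}.
Proof.
move=> v0 x y xy.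
suff : ipref v (x + `|x| * m) <= ipref v (y + `|x| * m) by rewrite !iprefM lerD2r.
have : 0 <= x + `|x| * m.
  by rewrite (le_trans (_ : 0 <= x + `|x|)) ?lerD2l ?ler_peMr //; lia.
have : x + `|x| * m <= y + `|x| * m by rewrite lerD2r.
case: (x + _) => // a; case: (y + _) => // b ab _.
by rewrite !ipref_nat psum_homo.
Qed.

Definition icut (e c1 c2 : nat) (s : int) : int :=
  (if (s %% 3)%Z == 0 then e else if (s %% 3)%Z == 1 then c1 else c2)%:Z + (s %/ 3)%Z * m.

Lemma icutE e c1 c2 (q : int) :
  [/\ icut e c1 c2 (3 * q) = e%:Z + q * m, icut e c1 c2 (3 * q + 1) = c1%:Z + q * m
    & icut e c1 c2 (3 * q + 2) = c2%:Z + q * m].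
Proof.
rewrite /icut mulrC divzMDl // modzMDl mulzK // modzMl.
by rewrite !divzMDl // !modzMDl /= !addr0.
Qed.

(** The inequality carries acceptance under the lowered utility back to [u], with the same maximin
    share. *)
Lemma agent_of u : (forall x, 0 <= u x) ->
  exists2 A : agent R m%:Z, level A = mms 3 u &
    forall a b, (a <= b)%N -> pref A b%:Z - pref A a%:Z <= psum u b - psum u a.
Proof.
move=> u0; have [v [v0 [e [c1 [c2 [[h1 h2 h3] [E1 E2 E3]]]]]]] := normal_form u0.
have v0' x : 0 <= v x by case/andP: (v0 x).
have tot : usum v [set: 'I_m] = 3 * mms 3 u.
  by have := psum_period v e; rewrite E3 E2 E1; lra.
pose cut3 := icut e c1 c2.
have e12 (q : int) : 3 * q + 1 + 1 = 3 * q + 2 by lia.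
have e23 (q : int) : 3 * q + 2 + 1 = 3 * (q + 1) by lia.
have cut_leS (s : int) : cut3 s <= cut3 (s + 1).
  rewrite /cut3; have [q [->|->|->]] := residue3 s.
  - by have [-> -> _] := icutE e c1 c2 q; rewrite lerD2r.
  - by rewrite e12; have [_ -> ->] := icutE e c1 c2 q; rewrite lerD2r.
  - rewrite e23; have [_ _ ->] := icutE e c1 c2 q; have [-> _ _] := icutE e c1 c2 (q + 1).
    by rewrite mulrDl mul1r addrCA addrC lerD2r; lia.
have cut_period (s : int) : cut3 (s + 3) = cut3 s + m.
  by rewrite /cut3 /icut modzDr divzDr // mulrDl mul1r addrA.
have pref_cut (s : int) : ipref v (cut3 (s + 1)) = ipref v (cut3 s) + mms 3 u.
  rewrite /cut3; have [q [->|->|->]] := residue3 s.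
  - by have [-> -> _] := icutE e c1 c2 q; rewrite !iprefM !ipref_nat E1 addrAC.
  - by rewrite e12; have [_ -> ->] := icutE e c1 c2 q; rewrite !iprefM !ipref_nat E2 addrAC.
  - rewrite e23; have [_ _ ->] := icutE e c1 c2 q; have [-> _ _] := icutE e c1 c2 (q + 1).
    by rewrite !iprefM !ipref_nat intrD tot; lra.
have pref_period (x : int) : ipref v (x + m) = ipref v x + 3 * mms 3 u.
  by have := iprefM v x 1; rewrite mul1r mulr1 tot.
exists (Agent (ipref_homo v0') pref_period cut_leS cut_period pref_cut) => //= a b ab.
rewrite !ipref_nat (psum_cat v ab) (psum_cat u ab) !(addrC (psum _ a)) !addrK.
by apply: ler_sum => i _; case/andP: (v0 (inZp i)).
Qed.

Lemma stuck_nat (A B C : agent R m) :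
  (forall p q r : nat, (p <= q)%N -> (q <= r)%N -> (r <= p + m)%N ->
     ~~ [&& ok A p q, ok B q r & ok C r (p + m)%N]) ->
  stuck A B C.
Proof.
(* Acceptance is invariant under whole turns, and [k] turns bring all endpoints to the naturals. *)
move=> S p q r pq qr rp; pose k : int := `|p|.
have km : k <= k * m by rewrite ler_peMr // /k.
have lift (x : int) : p <= x -> exists a : nat, x + k * m = a.
  move=> px; have : 0 <= x + k * m by rewrite (le_trans _ (lerD px km)) //; lia.
  by case: (x + k * m) => // a _; exists a.
have [p' Ep] := lift p (lexx p); have [q' Eq] := lift q pq.
have [r' Er] := lift r (le_trans pq qr).
rewrite -(ok_periodM A _ _ k) -(ok_periodM B _ _ k) -(ok_periodM C _ _ k).
have -> : p + m + k * m = (p' + m)%N by rewrite addrAC Ep.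
rewrite Ep Eq Er; apply: S; lia.
Qed.

End Arcs.

Theorem theorem4p12 (R : realFieldType) (m : nat) (us : 'I_3 -> 'I_m -> R) :
  (forall (i : 'I_3) (g : 'I_m), 0 <= us i g) ->
  exists P : {ffun 'I_3 -> {set 'I_m}}, c_sufficient (5 / 6) us P.
Proof.
case: m us => [|n] us us0.
  exists [ffun=> set0]; split.
    apply/and3P; split.
    - by apply/forallP=> i; apply/forallP; case.
    - apply/forallP=> i; apply/forallP=> j; apply/implyP=> _.
      by rewrite disjoint_subset; apply/subsetP; case.
    - by apply/eqP/setP; case.
  move=> i; have -> : mms 3 (us i) = 0.
    have [//|[P _ /(_ ord0) H]] := mms_attained 3 (us i).
    apply/le_anti; rewrite mms_ge0 andbT; apply: le_trans H _.
    by rewrite /usum big1 // => -[].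
  by rewrite mulr0 sumr_ge0.
have [A0 L0 H0] := agent_of (us0 ord0).
pose i1 : 'I_3 := inord 1.
have [A1 L1 H1] := agent_of (us0 i1).
have [A2 L2 H2] := agent_of (us0 ord_max).
have U012 : uniq [:: ord0; i1; ord_max] by rewrite /= !inE -!val_eqE /= inordK.
have U021 : uniq [:: ord0; ord_max; i1] by rewrite /= !inE -!val_eqE /= inordK.
(* Sufficiency as a boolean on a finite type makes the argument by contradiction available. *)
pose good (P : {ffun 'I_3 -> {set 'I_n.+1}}) :=
  is_split P && [forall i, 5 / 6 * mms 3 (us i) <= usum (us i) (P i)].
have [/existsP[P /andP[sP /forallP gP]]|none] := boolP [exists P, good P].
  by exists P.
(* Three acceptable consecutive arcs would form a good split, in whatever order the agents receive
   them. *)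
have stuckP i j k (A B C : agent R n.+1) : uniq [:: i; j; k] ->
    level A = mms 3 (us i) -> level B = mms 3 (us j) -> level C = mms 3 (us k) ->
    (forall a b, (a <= b)%N -> pref A b%:Z - pref A a%:Z <= psum (us i) b - psum (us i) a) ->
    (forall a b, (a <= b)%N -> pref B b%:Z - pref B a%:Z <= psum (us j) b - psum (us j) a) ->
    (forall a b, (a <= b)%N -> pref C b%:Z - pref C a%:Z <= psum (us k) b - psum (us k) a) ->
  stuck A B C.
  move=> U LA LB LC HA HB HC; apply: stuck_nat => p q r pq qr rp.
  apply: contra none => /and3P[oA oB oC]; apply/existsP.
  have [P [all3 sP Pi Pj Pk]] := split_of_arcs pq qr rp U.
  exists P; rewrite /good sP /=; apply/forallP=> x.
  case/or3P: (all3 x) => /eqP->.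
  - rewrite Pi usum_arc //; last by lia.
    by rewrite -LA; apply: le_trans oA (HA _ _ pq).
  - rewrite Pj usum_arc //; last by lia.
    by rewrite -LB; apply: le_trans oB (HB _ _ qr).
  - rewrite Pk usum_arc //; last by lia.
    by rewrite -LC; apply: le_trans oC (HC _ _ rp).
case: (@alloc_exists R n.+1 isT A0 A1 A2); split.
- exact: (stuckP _ _ _ A0 A1 A2 U012).
- exact: (stuckP _ _ _ A0 A2 A1 U021).
Qed.
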